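(* Let $n\ge 2$ be an integer, let $a<b$, and let $u\in C^{n}((a,b))\cap C^{n-1}((a,b])$ be a real-valued function satisfying $$u^{(n)}(x)+a_{n-1}(x)u^{(n-1)}(x)+\cdots+a_1(x)u'(x)+a_0(x)u(x)\le 0\quad\text{for } x\in(a,b),$$ where $a_{n-1},\dots,a_1,a_0$ are real-valued functions in $C((a,b])$. Suppose $$u(b)=u'(b)=\cdots=u^{(n-2)}(b)=0.$$ - If $n$ is even and there exists a sequence $\{x_i\}$ such that $a<x_i<b$, $x_i\to b$, and $u(x_i)>0$ for all $i$, then $u^{(n-1)}(b)<0$ and $u>0$ in a neighborhood of $b$ (i.e. there is $\delta>0$ with $u(x)>0$ for all $x\in(b-\delta,b)$). - If $n$ is odd and there exists a sequence $\{x_i\}$ such that $a<x_i<b$, $x_i\to b$, and $u(x_i)<0$ for all $i$, then $u^{(n-1)}(b)<0$ and $u<0$ in a neighborhood of $b$ (i.e. there is $\delta>0$ with $u(x)<0$ for all $x\in(b-\delta,b)$). When $n=2$, the same conclusion holds if, instead of $a_1,a_0\in C((a,b])$, one only assumes that $a_1$ and $a_0$ are bounded functions.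
   Context: $C^{n-1}((a,b])$ denotes functions that are $n-1$ times continuously differentiable up to the endpoint $b$, with derivatives at $b$ understood as one-sided derivatives. $C((a,b])$ denotes the continuous functions on $(a,b]$. *)

(* Defs.v *)
From HB Require Import structures.
From mathcomp Require Import all_boot all_order all_algebra.
From mathcomp Require Import all_classical all_reals all_analysis.
Set Implicit Arguments.
Unset Strict Implicit.
Unset Printing Implicit Defensive.
Import Order.TTheory GRing.Theory Num.Theory.
Import numFieldNormedType.Exports.
Local Open Scope classical_set_scope.
Local Open Scope ring_scope.

Definition diff_quotient (R : realType) (f : R -> R) (x y : R) : R :=
  (f y - f x) / (y - x).

(* The limit is taken along points of A other than x.  It is the usual
   derivative if x is interior to A, and the left derivative if x is the right
   endpoint of the interval A. *)
Definition derivable_within (R : realType) (A : set R) (f : R -> R) (x : R) :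
    Prop :=
  cvg (diff_quotient f x y @[y --> within A x^']).

Definition derive1_within (R : realType) (A : set R) (f : R -> R) (x : R) : R :=
  lim (diff_quotient f x y @[y --> within A x^']).

Definition derive1n_within (R : realType) (A : set R) (k : nat) (f : R -> R) :
    R -> R :=
  iter k (derive1_within A) f.

(* f is in C^k((a, b)) *)
Definition Ck_oo (R : realType) (k : nat) (a b : R) (f : R -> R) : Prop :=
  (forall j, (j < k)%N -> {in `]a, b[, forall x, derivable (derive1n j f) x 1}) /\
  {in `]a, b[, continuous (derive1n k f)}.

(* f is in C^k((a, b]), with one-sided derivatives at b *)
Definition Ck_oc (R : realType) (k : nat) (a b : R) (f : R -> R) : Prop :=
  (forall j, (j < k)%N ->
    {in `]a, b], forall x,
      derivable_within `]a, b] (derive1n_within `]a, b] j f) x}) /\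
  {within `]a, b], continuous (derive1n_within `]a, b] k f)}.

(* Main.v *)
Require Import Defs.
From HB Require Import structures.
From mathcomp Require Import all_boot all_order all_algebra.
From mathcomp Require Import all_classical all_reals all_analysis.
From mathcomp Require Import ring lra.
Import Order.TTheory GRing.Theory Num.Theory.
Import numFieldNormedType.Exports.
Local Open Scope classical_set_scope.
Local Open Scope ring_scope.

(** Reflect at the endpoint: put t = b - x and let g_k be the k-th derivative
of t |-> (-1)^n u(b - t).  Then g_n(t) = u^(n)(b - t) whatever the
parity of n, so that on some interval (0, d)

  g_n <= M * (|g_0| + ... + |g_(n-1)|),

where M bounds the coefficients near b; g_k tends to 0 at 0+ for k <= n - 2,
and g_(n-1) tends to alpha = - u^(n-1)(b).  It is assumed that g_0 is positive
at points arbitrarily close to 0, and alpha > 0 and g_0 > 0 near 0 have to be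
shown ([derivative_chain_alternative]).

If alpha > 0, then g_(n-1) > 0 near 0, and integrating from 0 down the chain
g_k' = g_(k+1) gives g_0 > 0 near 0.  It remains to refute alpha <= 0, and for
this it suffices that y = g_(n-2) satisfies y <= 0 near 0, since integrating
down the chain then gives g_0 <= 0 near 0.

The function y satisfies the second-order inequality y'' <= C (|y'| + N) on
(0, t) whenever |y| <= N on (0, t], since the terms g_k with k < n - 2 are
iterated integrals of y.  Suppose y(t) > 0 for a small t, and let N be the
maximum of |y| on [0, t].  The inequality and alpha <= 0 prevent y' from
rising above a multiple of C N t ([barrier_lt0]), so y cannot increase by as
much as N within [0, t].  But if the maximum N of |y| is a positive value of
y, then y increased by N from its limit 0 at 0; and if it is a negative value,
then y increased by more than N from there to y(t) > 0: a contradiction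
([nonlocal_comparison]).  Only upper bounds for y' are available, since the
equation bounds y'' on one side only; this is why the argument controls the
increase of y rather than |y| itself.

The coefficients enter through their boundedness near b, which both
alternatives of the assumption on them provide. *)

Set Implicit Arguments.
Unset Strict Implicit.

(** * Calculus on an interval (0, d) with limits at 0+ *)

Lemma derive_continuous (R : realType) (h : R -> R) (x l : R) :
  is_derive x 1 h l -> {for x, continuous h}.
Proof.
by case=> dh _; apply: differentiable_continuous; apply/derivable1_diffP.
Qed.

Lemma mean_value (R : realType) (h h' : R -> R) (d s t : R) :
  (forall x : R, 0 < x < d -> is_derive x 1 h (h' x)) ->
  0 < s -> s < t -> t < d ->
  exists2 c, s < c < t & h t - h s = h' c * (t - s).
Proof.
move=> dh s0 st td.
have [||c] := MVT st (df := h') (f := h).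
- move=> x; rewrite in_itv/= => /andP[sx xt]; apply: dh.
  by rewrite (lt_trans s0 sx) (lt_trans xt td).
- apply: derivable_within_continuous => x; rewrite in_itv/= => /andP[sx xt].
  have /dh[]// : 0 < x < d by rewrite (lt_le_trans s0 sx) (le_lt_trans xt td).
by rewrite in_itv/= => ? ?; exists c.
Qed.

(** The mean value theorem on [s, t], with s tending to 0, where h is known only
through its limit. *)
Lemma le_of_derive_le (R : realType) (h h' : R -> R) (d l K : R) :
  (forall x : R, 0 < x < d -> is_derive x 1 h (h' x)) ->
  h x @[x --> 0^'+] --> l ->
  forall t : R, 0 < t < d -> (forall x : R, 0 < x < t -> h' x <= K) ->
  h t <= l + K * t.
Proof.
move=> dh hl t /andP[t0 td] hK.
have cv : h s + K * (t - s) @[s --> 0^'+] --> l + K * (t - 0).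
  apply: cvgD hl _; apply: cvgM (cvg_cst _) _.
  apply: cvgB; [exact: cvg_cst|exact: cvg_at_right_filter].
rewrite subr0 in cv; apply: cvgr_to_ge cv _; near=> s.
have [s0 st] : 0 < s /\ s < t.
  by split; near: s; [exact: nbhs_right_gt|exact: nbhs_right_lt].
have [c /andP[sc ct] E] := mean_value dh s0 st td.
rewrite -lerBlDl E ler_wpM2r ?subr_ge0 ?(ltW st)// hK//.
by rewrite (lt_trans s0 sc) ct.
Unshelve. all: by end_near. Qed.

Lemma gt0_of_derive_gt0 (R : realType) (h h' : R -> R) (d : R) :
  (forall x : R, 0 < x < d -> is_derive x 1 h (h' x)) ->
  h x @[x --> 0^'+] --> 0 ->
  (forall x : R, 0 < x < d -> 0 < h' x) ->
  forall t : R, 0 < t < d -> 0 < h t.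
Proof.
move=> dh h0 hp t /andP[t0 td].
have t20 : 0 < t / 2 by lra.
have t2t : t / 2 < t by lra.
have h2 : 0 <= h (t / 2).
  have dN (x : R) : 0 < x < d -> is_derive x 1 (- h) (- h' x).
    by move=> /dh ?; exact: is_deriveN.
  have t2d : 0 < t / 2 < d by rewrite t20 (lt_trans t2t).
  have := le_of_derive_le (K := 0) dN (cvgN h0) t2d.
  rewrite oppr0 mul0r addr0 oppr_le0; apply=> x /andP[x0 xt].
  by rewrite oppr_le0 ltW// hp// x0 (lt_trans xt)// (lt_trans t2t).
have [c /andP[sc ct] E] := mean_value dh t20 t2t td.
apply: le_lt_trans h2 _; rewrite -subr_gt0 E mulr_gt0 ?subr_gt0// hp//.
by rewrite (lt_trans t20 sc) (lt_trans ct td).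
Qed.

(** The first zero would be reached from below, so the derivative there would be
nonnegative. *)
Lemma barrier_lt0 (R : realType) (f f' : R -> R) (d : R) :
  (forall x : R, 0 < x < d -> is_derive x 1 f (f' x)) ->
  (\forall x \near 0^'+, f x < 0) ->
  (forall x : R, 0 < x < d -> f x = 0 -> f' x < 0) ->
  forall t : R, 0 < t < d -> f t < 0.
Proof.
move=> df near0 down t1 /andP[t10 t1d]; rewrite ltNge; apply/negP => ft1.
(* The first zero is the infimum i of the points at which f is nonnegative. *)
pose A := [set t | 0 < t <= t1 /\ 0 <= f t].
have At1 : A t1 by split => //; rewrite t10 lexx.
have [e /= e0 He] := near0.
have {}He (x : R) : 0 < x < e -> f x < 0.
  by move=> /andP[x0 xe]; apply: He => //=; rewrite sub0r normrN gtr0_norm.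
have lbA : lbound A e.
  move=> x [/andP[x0 _] fx]; rewrite leNgt; apply/negP => xe.
  by move: fx; rewrite leNgt He// x0.
have infA : has_inf A by split; [exists t1|exists e].
pose i := inf A.
have i0 : 0 < i by apply: lt_le_trans e0 _; exact: lb_le_inf (proj1 infA) lbA.
have it1 : i <= t1 by apply: ge_inf => //; exact: (proj2 infA).
have id : 0 < i < d by rewrite i0 (le_lt_trans it1).
have fneg (x : R) : 0 < x < i -> f x < 0.
  move=> /andP[x0 xi]; rewrite ltNge; apply/negP => fx.
  have : i <= x.
    apply: ge_inf; first exact: (proj2 infA).
    by split=> //; rewrite x0 (ltW (lt_le_trans xi it1)).
  by rewrite leNgt xi.
have dfi := df _ id.
have ci := derive_continuous dfi.
have fi_le0 : f i <= 0.
  have cl : f x @[x --> i^'-] --> f i by exact: cvg_at_left_filter.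
  apply: cvgr_to_le cl _.
  near=> x; apply/ltW/fneg/andP; split; near: x.
    exact: nbhs_left_gt.
  exact: nbhs_left_lt.
have fi_ge0 : 0 <= f i.
  rewrite leNgt; apply/negP => fi.
  have [r /= r0 Hr] := cvgr_lt _ ci _ fi.
  have [x Ax xir] := inf_adherent r0 infA.
  have ix : i <= x by apply: ge_inf => //; exact: (proj2 infA).
  have : f x < 0.
    by apply: Hr; rewrite /= distrC ger0_norm ?subr_ge0// ltrBlDl.
  by case: Ax => _; rewrite leNgt => /negP.
have fi : f i = 0 by apply/eqP; rewrite eq_le fi_le0.
have f'i := down _ id fi.
have [der val] := dfi.
have : 0 <= f' i.
  rewrite -val.
  have dl := cvg_dnbhs_at_left der; apply: cvgr_to_ge dl _.
  near=> h.
  have h0 : h < 0 by near: h; exact: nbhs_left_lt.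
  have hi : - i < h by near: h; apply: nbhs_left_gt; rewrite oppr_lt0.
  rewrite fi subr0 /GRing.scale/= mulr1.
  rewrite nmulr_rge0 ?invr_lt0//; apply/ltW/fneg; apply/andP; split; lra.
by rewrite leNgt f'i.
Unshelve. all: by end_near. Qed.

(** * The comparison near 0 *)

(** The differential inequality is nonlocal: the bound N is a bound of |y| on
the whole of (0, t].  This is what remains of an inequality of higher order when
its lower-order terms are estimated by iterated integrals of y.  The last two
hypotheses fix how close to 0 the point t has to be. *)
Lemma nonlocal_comparison (R : realType) (y y1 y2 : R -> R) (d C alpha : R) :
  (forall x : R, 0 < x < d -> is_derive x 1 y (y1 x)) ->
  (forall x : R, 0 < x < d -> is_derive x 1 y1 (y2 x)) ->
  y x @[x --> 0^'+] --> 0 ->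
  y1 x @[x --> 0^'+] --> alpha -> alpha <= 0 ->
  0 < C ->
  (forall N t : R, 0 < t < d ->
    (forall s : R, 0 < s <= t -> `|y s| <= N) ->
    forall s : R, 0 < s < t -> y2 s <= C * (`|y1 s| + N)) ->
  forall t : R, 0 < t < d -> t <= 2^-1 -> C * t <= 4^-1 -> y t <= 0.
Proof.
move=> dy dy1 y0 y10 alpha0 C0 ineq t1 t1d t1h Ct1.
have [t10 t1ltd] := andP t1d.
rewrite leNgt; apply/negP => yt1.
(* The value 0 at 0 makes |y| continuous on the closed interval [0, t1], so that
its maximum N is attained. *)
pose z x := `|if x <= 0 then 0 else y x|.
have zE x : 0 < x -> z x = `|y x| by rewrite /z ltNge => /negbTE ->.
have zcont : {within `[0, t1], continuous z}.
  have zy (x : R) : 0 < x < d -> z @ x --> `|y x|.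
    move=> xd; have [x0 _] := andP xd.
    apply: cvg_trans (cvg_norm (derive_continuous (dy _ xd))).
    apply: near_eq_cvg; near=> s; rewrite zE//.
    by near: s; exact: lt_nbhsr.
  apply/continuous_within_itvP => //; split.
  - move=> x; rewrite in_itv/= => /andP[x0 xt]; rewrite /continuous_at zE//.
    by apply: zy; rewrite x0 (lt_trans xt).
  - rewrite {2}/z lexx.
    apply: cvg_trans (cvg_norm y0); apply: near_eq_cvg; near=> s; rewrite zE//.
  - by rewrite zE//; apply/cvg_at_left_filter/zy.
have [c] := EVT_max (ltW t10) zcont; rewrite in_itv/= => /andP[c0 ct1] zmax.
set N := z c in zmax.
have yN (s : R) : 0 < s <= t1 -> `|y s| <= N.
  by move=> /andP[s0 st]; rewrite -zE// zmax// in_itv/= (ltW s0).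
have N0 : 0 < N.
  by apply: lt_le_trans (yN t1 _); rewrite ?t10 ?lexx// normr_gt0 gt_eqF.
have {}c0 : 0 < c.
  rewrite lt_neqAle c0 andbT; apply/eqP => c0'; move: N0.
  by rewrite /N -c0' /z lexx normr0 ltxx.
have NE : N = `|y c| by rewrite /N zE.
pose A := 3 * (C * N).
have A0 : 0 < A by rewrite !mulr_gt0.
(* The barrier for y1 is the line A (s + t1).  The shift by t1 makes it positive
   at 0, where y1 may tend to 0.  On the line y1 <= 2 A t1, hence
   y2 <= 2 C A t1 + C N <= A / 2 + A / 3 < A, the slope of the line. *)
have y1lt (s : R) : 0 < s < t1 -> y1 s < 2 * (A * t1).
  move=> st; suff : y1 s - A * (s + t1) < 0.
    have [s0 s1] := andP st.
    have : A * s < A * t1 by rewrite ltr_pM2l.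
    by rewrite mulrDr; lra.
  apply: (@barrier_lt0 _ (fun x => y1 x - A * (x + t1)) (fun x => y2 x - A) t1).
  - move=> x /andP[x0 xt].
    have xd : 0 < x < d by rewrite x0 (lt_trans xt).
    have ? := dy1 _ xd.
    apply: is_derive_eq; by rewrite /GRing.scale/= !(mulr0, addr0, mulr1).
  - have : y1 x - A * (x + t1) @[x --> 0^'+] --> alpha - A * (0 + t1).
      apply: cvgB y10 _; apply: cvgM (cvg_cst _) _.
      by apply: cvgD (cvg_cst _); exact: cvg_at_right_filter.
    move=> /cvgr_lt; apply; rewrite add0r.
    by have := mulr_gt0 A0 t10; lra.
  - move=> x xt /eqP; rewrite subr_eq0 => /eqP E.
    have [x0 xt1] := andP xt.
    have := ineq N t1 t1d yN x xt.
    rewrite E ger0_norm; last by rewrite mulr_ge0// ?ltW// addr_gt0.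
    have : A * (C * x) <= A * 4^-1.
      by rewrite ler_pM2l// (le_trans _ Ct1)// ler_pM2l// ltW.
    have : A * (C * t1) <= A * 4^-1 by rewrite ler_pM2l.
    have -> : C * (A * (x + t1) + N) = A * (C * x) + A * (C * t1) + C * N by ring.
    by move: A0; rewrite /A; lra.
  - exact: st.
pose B := 2 * (A * t1).
have B0 : 0 < B by rewrite !mulr_gt0.
(* B * t1 = 6 (C * t1) N t1 with C * t1 <= 1/4 and t1 <= 1/2. *)
have BN : B * t1 < N.
  have : N * (C * t1) <= N * 4^-1 by rewrite ler_pM2l.
  have : B * t1 <= B * 2^-1 by rewrite ler_pM2l.
  have -> : B = 6 * (N * (C * t1)) by rewrite /B /A; ring.
  lra.
have Blt (s t : R) : 0 < s -> s <= t -> t <= t1 -> y t - y s <= B * t1.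
  move=> s0; rewrite le_eqVlt => /orP[/eqP ->|st tt1].
    by rewrite subrr mulr_ge0 // ltW.
  have [x /andP[sx xt] ->] := mean_value dy s0 st (le_lt_trans tt1 t1ltd).
  apply: (@le_trans _ _ (B * (t - s))).
    by rewrite ler_wpM2r ?subr_ge0 ?(ltW st)// ltW// y1lt//
      (lt_trans s0) ?(lt_le_trans xt).
  by rewrite ler_pM2l//; lra.
have [yc|yc] := leP 0 (y c).
- move: NE; rewrite ger0_norm// => NE.
  have cd : 0 < c < d by rewrite c0 (le_lt_trans ct1).
  have := le_of_derive_le (K := B) dy y0 cd.
  rewrite add0r -NE => /(_ _)/wrap[x /andP[x0 xc]|].
    by rewrite ltW// y1lt// x0 (lt_le_trans xc).
  have : B * c <= B * t1 by rewrite ler_pM2l.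
  by move: BN; lra.
- move: NE; rewrite ltr0_norm// => NE.
  by have := Blt c t1 c0 ct1 (lexx _); move: BN yt1; lra.
Unshelve. all: by end_near. Qed.

Lemma downward_ind (P : nat -> Prop) (m : nat) :
  P m -> (forall k, (k < m)%N -> P k.+1 -> P k) ->
  forall k, (k <= m)%N -> P k.
Proof.
move=> Pm step k km; rewrite -(subKn km).
elim: (m - k)%N (leq_subr k m) => [|j IH] jm.
  by rewrite subn0.
apply: step; first by rewrite ltn_subrL (leq_trans _ jm).
by rewrite subnSK//; exact/IH/ltnW.
Qed.

(** Near 0, each g_k with k <= m inherits the sign of g_(k+1), being its
integral from 0.  For alpha > 0 this starts from g_(m+1).  For alpha <= 0 the
sign of g_(m+1) need not settle, and the descent starts from g_m, whose sign
is given by [nonlocal_comparison]; it contradicts the last hypothesis. *)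
Lemma derivative_chain_alternative (R : realType) (m : nat) (g : nat -> R -> R)
    (d M alpha : R) :
  0 < d -> 0 <= M ->
  (forall k (x : R), (k < m.+2)%N -> 0 < x < d ->
    is_derive x 1 (g k) (g k.+1 x)) ->
  (forall k, (k <= m)%N -> g k x @[x --> 0^'+] --> 0) ->
  g m.+1 x @[x --> 0^'+] --> alpha ->
  (forall x : R, 0 < x < d -> g m.+2 x <= M * \sum_(k < m.+2) `|g k x|) ->
  (forall e : R, 0 < e -> exists2 t, 0 < t < e & 0 < g 0 t) ->
  0 < alpha /\ \forall t \near 0^'+, 0 < g 0 t.
Proof.
move=> d0 M0 dg g0 galpha ineq pos.
have dgd k e (x : R) : (k < m.+2)%N -> e <= d -> 0 < x < e ->
    is_derive x 1 (g k) (g k.+1 x).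
  by move=> km ed /andP[x0 xe]; apply: dg => //; rewrite x0 (lt_le_trans xe).
have [alpha_gt0|alpha_le0] := ltP 0 alpha.
- split=> //.
  have [e /= e0 He] : \forall t \near 0^'+, 0 < g m.+1 t.
    exact: cvgr_gt galpha _ alpha_gt0.
  have gt0 : forall k, (k <= m.+1)%N ->
      forall t : R, 0 < t < Num.min d e -> 0 < g k t.
    apply: downward_ind => [t /andP[t0]|k km IH].
      by rewrite lt_min => /andP[_ te]; apply: He => //=;
        rewrite sub0r normrN gtr0_norm.
    apply: gt0_of_derive_gt0 (g0 _ _) IH => // x.
    by apply: dgd; [exact: ltnW|rewrite ge_min lexx].
  have me0 : 0 < Num.min d e by rewrite lt_min d0.
  near=> t; apply: (gt0 0%N) => //.
  by apply/andP; split; near: t; [exact: nbhs_right_gt|exact: nbhs_right_lt].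
- exfalso.
  pose C := M * m.+1%:R + 1.
  have C0 : 0 < C by rewrite ltr_wpDl// mulr_ge0.
  pose e := Num.min d (Num.min 2^-1 (4 * C)^-1).
  have e0 : 0 < e by rewrite !lt_min d0 !invr_gt0 pmulr_rgt0 ?C0 !ltr0n.
  have ed : e <= d by rewrite /e ge_min lexx.
  have eh : e <= 2^-1 by rewrite /e !ge_min lexx orbT.
  have eC : C * e <= 4^-1.
    have : e <= (4 * C)^-1 by rewrite /e !ge_min lexx !orbT.
    by rewrite -(ler_pM2l C0) invfM mulrCA mulfV ?mulr1// gt_eqF.
  have gm (t : R) : 0 < t < e -> g m t <= 0.
    move=> te; have [t0 t_lt] := andP te.
    apply: (@nonlocal_comparison _ (g m) (g m.+1) (g m.+2) e C alpha) => //.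
    + by move=> x; exact: dgd.
    + by move=> x; exact: dgd.
    + exact: g0.
    + move=> N r /andP[r0 re] gN x /andP[x0 xr].
      (* As r <= 1, integrating from 0 does not increase the bound N, so it
         passes from g m to all earlier terms of the chain. *)
      have gkN : forall k, (k <= m)%N ->
          forall s : R, 0 < s <= r -> `|g k s| <= N.
        apply: downward_ind => // k km IH s /andP[s0 sr].
        have sd : 0 < s < e by rewrite s0 (le_lt_trans sr).
        have dk (z : R) : 0 < z < e -> is_derive z 1 (g k) (g k.+1 z).
          by apply: dgd => //; rewrite (ltn_trans km).
        have dNk (z : R) : 0 < z < e -> is_derive z 1 (- g k) (- g k.+1 z).
          by move=> /dk ?; exact: is_deriveN.
        have kz : g k x @[x --> 0^'+] --> 0 by exact/g0/ltnW.
        have N0 : 0 <= N by rewrite (le_trans _ (IH s _)) ?s0.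
        have Ns : N * s <= N by rewrite ler_piMr//; lra.
        have IHz (z : R) : 0 < z < s -> `|g k.+1 z| <= N.
          by move=> /andP[z0 zs]; rewrite IH// z0 ltW// (lt_le_trans zs).
        rewrite ler_norml; apply/andP; split.
          rewrite lerNl; apply: le_trans Ns; rewrite -[leRHS]add0r.
          rewrite -oppr0; apply: (le_of_derive_le dNk (cvgN kz) sd) => z /IHz.
          by rewrite ler_norml => /andP[]; rewrite lerNl.
        apply: le_trans Ns; rewrite -[leRHS]add0r.
        apply: (le_of_derive_le dk kz sd) => z /IHz.
        by rewrite ler_norml => /andP[].
      have xd : 0 < x < d by rewrite x0 (lt_trans xr)// (lt_le_trans re).
      apply: (le_trans (ineq _ xd)).
      have N0 : 0 <= N by apply: le_trans (gN x _) => //; rewrite x0 ltW.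
      have S : \sum_(k < m.+2) `|g k x| <= m.+1%:R * N + `|g m.+1 x|.
        rewrite big_ord_recr/= lerD2r.
        apply: (@le_trans _ _ (\sum_(k < m.+1) N)).
          by apply: ler_sum => k _; rewrite gkN ?x0 ?(ltW xr)// -ltnS.
        by rewrite sumr_const card_ord mulr_natl.
      apply: (le_trans (ler_wpM2l M0 S)).
      have m1 : 1 <= m.+1%:R :> R by rewrite ler1n.
      have := mulr_ge0 M0 (normr_ge0 (g m.+1 x)).
      set w := `|_|; have w0 : 0 <= w by exact: normr_ge0.
      move=> Mw; have : M * w <= M * w * m.+1%:R by rewrite ler_peMr.
      by rewrite /C; nra.
    + by rewrite ltW// (lt_le_trans t_lt).
    + by apply: le_trans eC; rewrite ler_pM2l// ltW.
  have [t te] := pos _ e0; rewrite ltNge => /negP; apply.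
  suff : forall k, (k <= m)%N -> forall t : R, 0 < t < e -> g k t <= 0 by exact.
  apply: downward_ind => // k km IH s se.
  rewrite -[leRHS]addr0 -{2}(mul0r s); apply: (le_of_derive_le _ _ se).
  + by move=> x; apply: dgd => //; rewrite (ltn_trans km).
  + exact/g0/ltnW.
  + move=> x /andP[x0 xs]; apply: IH; rewrite x0 (lt_trans xs)//.
    by have /andP[] := se.
Unshelve. all: by end_near. Qed.

(** * One-sided derivatives at the right endpoint *)

Lemma within_dnbhs_at_left (R : realType) (a b x : R) : a < x <= b ->
  x^'- --> within `]a, b] x^'.
Proof.
move=> /andP[ax xb] P H; change (\forall y \near x, y < x -> P y); near=> y => yx.
have ay : a < y by near: y; exact: lt_nbhsr.
have : y != x -> `]a, b]%classic y -> P y by near: y; exact: H.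
by apply; rewrite ?lt_eqF//= in_itv/= ay (ltW (lt_le_trans yx xb)).
Unshelve. all: by end_near. Qed.

Lemma within_dnbhs_proper (R : realType) (a b x : R) : a < x <= b ->
  ProperFilter (within `]a, b]%classic x^').
Proof.
move=> /within_dnbhs_at_left xb; apply: Build_ProperFilter_ex => P /xb.
exact: filter_ex.
Qed.

(** Being a limit at x, the derivative sees only values near x, so that the
restriction to ]a, b] is invisible at interior points.  The function g is
separate from f because iterated derivatives agree on ]a, b[ only. *)
Lemma derive1_within_interior (R : realType) (a b x : R) (f g : R -> R) :
  {in `]a, b[, g =1 f} -> x \in `]a, b[ -> derivable f x 1 ->
  derive1_within `]a, b] g x = derive1 f x.
Proof.
move=> gf xab dfx; move: (xab); rewrite in_itv/= => /andP[ax xb].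
have ? : ProperFilter (within `]a, b]%classic x^').
  by apply: within_dnbhs_proper; rewrite ax ltW.
apply: cvg_lim => //.
apply: cvg_trans (_ : diff_quotient g x @ x^' --> derive1 f x).
  by apply: cvg_app; exact: cvg_within.
rewrite derive1E; apply/cvgrPdist_lt => e e0.
have /cvgrPdist_lt/(_ _ e0)[r /= r0 Hr] := dfx.
near=> y.
have yab : y \in `]a, b[.
  by rewrite in_itv/=; apply/andP; split; near: y; apply: cvg_within;
    [exact: lt_nbhsr|exact: lt_nbhsl].
have yx : y != x by near: y; exact: nbhs_dnbhs_neq.
have yr : `|y - x| < r.
  by rewrite distrC; near: y; apply: cvg_within; exists r.
have := Hr (y - x); rewrite /= sub0r normrN => /(_ yr).
rewrite subr_eq0 => /(_ yx); rewrite /diff_quotient !gf//.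
by rewrite /GRing.scale/= mulr1 subrK mulrC.
Unshelve. all: by end_near. Qed.

Lemma derive1n_within_interior (R : realType) (a b : R) (f : R -> R) (k : nat) :
  (forall j, (j < k)%N -> {in `]a, b[, forall x, derivable (derive1n j f) x 1}) ->
  {in `]a, b[, derive1n_within `]a, b] k f =1 derive1n k f}.
Proof.
elim: k => [//|k IH] df x xab; apply: derive1_within_interior => //.
  by apply: IH => j jk; apply: df; exact: ltnW.
by apply: df.
Qed.

Lemma derivable_within_cvg_left (R : realType) (a b : R) (f : R -> R) :
  a < b -> derivable_within `]a, b] f b -> f x @[x --> b^'-] --> f b.
Proof.
move=> ab df.
have cq : diff_quotient f b x @[x --> b^'-] --> derive1_within `]a, b] f b.
  have dl : diff_quotient f b x @[x --> within `]a, b] b^'] -->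
      derive1_within `]a, b] f b := df.
  apply: cvg_trans dl; apply: cvg_app; apply: within_dnbhs_at_left.
  by rewrite ab lexx.
have cx : x - b @[x --> b^'-] --> b - b.
  by apply: cvgB; [exact: cvg_at_left_filter|exact: cvg_cst].
have h : f b + diff_quotient f b x * (x - b) @[x --> b^'-] -->
    f b + derive1_within `]a, b] f b * (b - b).
  by apply: cvgD (cvg_cst _) _; exact: cvgM cq cx.
move: h; rewrite subrr mulr0 addr0 => h.
apply: cvg_trans h; apply: near_eq_cvg; near=> x.
rewrite /= /diff_quotient divfK; last first.
  by rewrite subr_eq0 lt_eqF//; near: x; exact: nbhs_left_lt.
by rewrite addrC subrK.
Unshelve. all: by end_near. Qed.

Lemma within_continuous_cvg_left (R : realType) (a b : R) (f : R -> R) :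
  a < b -> {within `]a, b], continuous f} -> f x @[x --> b^'-] --> f b.
Proof.
move=> ab cf.
have mb : (a + b) / 2 < b by lra.
have : {within `[(a + b) / 2, b], continuous f}.
  apply: continuous_subspaceW cf => x /=; rewrite !in_itv/= => /andP[mx ->].
  by rewrite andbT (lt_le_trans _ mx)//; lra.
by move=> /(continuous_within_itvP _ mb)[].
Qed.

Lemma cvg_reflect (R : realType) (f : R -> R) (b l : R) :
  f x @[x --> b^'-] --> l -> f (b - t) @[t --> 0^'+] --> l.
Proof. by move=> fl P /fl; exact: (nbhs_left0P b _).1. Qed.

(** The factor (-1)^n makes the two parities a single statement: it is the sign
that the reflection x |-> b - x puts in front of the n-th derivative. *)
Lemma endpoint_alternative (R : realType) (n : nat) (a b : R) (u : R -> R)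
    (c : 'I_n -> R -> R) :
  (2 <= n)%N -> a < b -> Ck_oo n a b u -> Ck_oc n.-1 a b u ->
  (forall k, bounded_near (c k) b^'-) ->
  (forall x, a < x < b ->
     derive1n n u x + \sum_(k < n) c k x * derive1n k u x <= 0) ->
  (forall k, (k <= n - 2)%N -> derive1n_within `]a, b] k u b = 0) ->
  (exists x_ : nat -> R,
     [/\ forall i, a < x_ i < b, x_ @ \oo --> b &
         forall i, 0 < (-1) ^+ n * u (x_ i)]) ->
  derive1n_within `]a, b] n.-1 u b < 0 /\
  exists2 delta : R, 0 < delta &
    forall x, b - delta < x < b -> 0 < (-1) ^+ n * u x.
Proof.
case: n c => [//|[//|m]] c _ ab [du _] [dwu cwu] bc ineq u0 [x_ [xab xb upos]].
set n := m.+2 in c du dwu cwu bc ineq u0 upos *.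
have FE k : (k < n)%N ->
    {in `]a, b[, derive1n_within `]a, b] k u =1 derive1n k u}.
  move=> kn; apply: derive1n_within_interior => j jk; apply: du.
  exact: ltn_trans jk kn.
have Fcvg k : (k < n)%N ->
    derive1n k u x @[x --> b^'-] --> derive1n_within `]a, b] k u b.
  move=> kn.
  have : derive1n_within `]a, b] k u x @[x --> b^'-] -->
      derive1n_within `]a, b] k u b.
    move: kn; rewrite ltnS leq_eqVlt => /orP[/eqP->|km].
      exact: within_continuous_cvg_left cwu.
    apply: (@derivable_within_cvg_left _ a) => //; apply: dwu => //.
    by rewrite in_itv/= ab lexx.
  move=> h; apply: cvg_trans h; apply: near_eq_cvg; near=> x.
  rewrite FE// in_itv/=.
  by apply/andP; split; near: x; [exact: nbhs_left_gt|exact: nbhs_left_lt].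
(* The k-th derivative of t |-> (-1)^n u(b - t). *)
pose g k t := (-1) ^+ (n + k) * derive1n k u (b - t).
have gcvg k : (k < n)%N ->
    g k t @[t --> 0^'+] --> (-1) ^+ (n + k) * derive1n_within `]a, b] k u b.
  by move=> /Fcvg/cvg_reflect h; exact: cvgM (cvg_cst _) h.
have [M [M0 cM]] : exists M : R, 0 <= M /\
    \forall x \near b^'-, forall k, `|c k x| <= M.
  have ex k : exists2 M : R, 0 < M & \forall x \near b^'-, `|c k x| < M.
    exact: ex_strict_bound_gt0 (bc k).
  pose Mk k := s2val (cid2 (ex k)).
  have Mk0 k : 0 < Mk k by rewrite /Mk; case: cid2.
  exists (\sum_k Mk k); split; first by apply: sumr_ge0 => k _; exact: ltW.
  apply: filter_forall => k.
  have : \forall x \near b^'-, `|c k x| < Mk k by rewrite /Mk; case: cid2.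
  apply: filterS => x /ltW /le_trans; apply.
  by rewrite (bigD1 k)//= lerDl sumr_ge0// => j _; exact: ltW.
have [e /= e0 He] := cM.
pose d := Num.min e (b - a).
have d0 : 0 < d by rewrite lt_min e0 subr_gt0.
have db (x : R) : 0 < x < d -> [/\ b - x \in `]a, b[, a < b - x < b &
    forall k, `|c k (b - x)| <= M].
  move=> /andP[x0]; rewrite lt_min => /andP[xe xba].
  have axb : a < b - x < b by apply/andP; split; lra.
  split=> //.
  by apply: He => /=; [rewrite opprB addrC subrK gtr0_norm|lra].
have [] := @derivative_chain_alternative R m g d M
    ((-1) ^+ (n + m.+1) * derive1n_within `]a, b] m.+1 u b) d0 M0.
- move=> k x kn /db[xI _ _].
  have d1 : is_derive (b - x) 1 (derive1n k u) (derive1n k.+1 u (b - x)).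
    by split; [exact: du|rewrite -derive1E].
  have d2 : is_derive x 1 (fun t : R => b - t) (- 1).
    by apply: is_derive_eq; rewrite add0r mul1r.
  have d3 := is_derive1_comp (g := fun t : R => b - t) d1 d2.
  have d4 := is_deriveZ ((-1) ^+ (n + k)) d3.
  apply: (is_derive_eq (f := _ \*: (derive1n k u \o (fun t : R => b - t)))).
  by rewrite /g addnS exprS /GRing.scale/=; ring.
- move=> k km; have kn : (k < n)%N by rewrite ltnW.
  by have := gcvg _ kn; rewrite u0 ?mulr0// subn2.
- exact: gcvg.
- move=> x /db[_ /ineq I cx].
  rewrite /g addnn -signr_odd odd_double expr0 mul1r.
  move: I; rewrite addrC -lerBrDl sub0r => /le_trans; apply.
  rewrite -sumrN mulr_sumr; apply: ler_sum => k _.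
  apply: le_trans (ler_norm _) _.
  rewrite normrN normrM normrM normrX normrN1 expr1n mul1r.
  by rewrite ler_wpM2r.
- move=> r r0.
  have /cvgrPdist_lt/(_ _ r0)[N _ HN] := xb.
  exists (b - x_ N).
    have /andP[_ h] := xab N.
    by rewrite subr_gt0 h/= -(gtr0_norm (_ : 0 < b - x_ N)) ?subr_gt0// HN/=.
  by rewrite /g addn0 subKr.
have -> : (-1) ^+ (n + m.+1) = -1 :> R.
  by rewrite addSn addnn -signr_odd /= odd_double expr1.
rewrite mulN1r oppr_gt0 => Fneg [r /= r0 Hr]; split=> //.
exists r => // x /andP[rx xb'].
have := Hr (b - x); rewrite /g addn0 subKr/= sub0r normrN gtr0_norm ?subr_gt0//.
by apply=> //; lra.
Unshelve. all: by end_near. Qed.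

Unset Implicit Arguments.
Set Strict Implicit.

Theorem theorem1p3 (R : realType) (n : nat) (a b : R) (u : R -> R)
    (c : 'I_n -> R -> R)
    (hn : (2 <= n)%N) (hab : a < b)
    (hu_oo : Ck_oo n a b u) (hu_oc : Ck_oc n.-1 a b u)
    (hc : (forall k, {within `]a, b], continuous (c k)}) \/
          (n = 2%N /\ forall k, [bounded c k x | x in `]a, b[%classic]))
    (hineq : forall x, a < x < b ->
       derive1n n u x + \sum_(k < n) c k x * derive1n k u x <= 0)
    (hub : forall k, (k <= n - 2)%N -> derive1n_within `]a, b] k u b = 0) :
  (~~ odd n ->
   (exists x_ : nat -> R,
      [/\ forall i, a < x_ i < b, x_ @ \oo --> b & forall i, 0 < u (x_ i)]) ->
   derive1n_within `]a, b] n.-1 u b < 0 /\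
   exists2 delta : R, 0 < delta &
     forall x, b - delta < x < b -> 0 < u x) /\
  (odd n ->
   (exists x_ : nat -> R,
      [/\ forall i, a < x_ i < b, x_ @ \oo --> b & forall i, u (x_ i) < 0]) ->
   derive1n_within `]a, b] n.-1 u b < 0 /\
   exists2 delta : R, 0 < delta &
     forall x, b - delta < x < b -> u x < 0).
Proof.
have bc k : bounded_near (c k) b^'-.
  case: hc => [cc|[_ bc]].
    exact: cvg_bounded (within_continuous_cvg_left hab (cc k)).
  apply: sub_boundedr (bc k) => P HP; near=> x; apply: HP.
  rewrite /= in_itv/=; apply/andP; split; near: x.
    exact: nbhs_left_gt.
  exact: nbhs_left_lt.
have main := endpoint_alternative hn hab hu_oo hu_oc bc hineq hub.
split=> [even_n|odd_n] [x_ [xab xb xs]].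
- have sgn : (-1) ^+ n = 1 :> R by rewrite -signr_odd (negbTE even_n).
  have [|neg [r r0 Hr]] := main.
    by exists x_; split=> // i; rewrite sgn mul1r.
  by split=> //; exists r => // x /Hr; rewrite sgn mul1r.
- have sgn : (-1) ^+ n = -1 :> R by rewrite -signr_odd odd_n.
  have [|neg [r r0 Hr]] := main.
    by exists x_; split=> // i; rewrite sgn mulN1r oppr_gt0.
  by split=> //; exists r => // x /Hr; rewrite sgn mulN1r oppr_gt0.
Unshelve. all: by end_near. Qed.
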